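(* Let $X\subseteq2^\omega$ and let $f:2^\omega\to2^\omega$ be a continuous mapping. If $X$ is a $(\mathrm T')$-set, then so is $f(X)$.
   Context: $2^\omega$ is the Cantor cube with its product topology. $\omega^{\uparrow\omega}$ denotes the set of nondecreasing unbounded sequences of natural numbers. A set $X\subseteq 2^\omega$ is a $(\mathrm T')$-set if there is $g\in\omega^\omega$ such that for each $h\in\omega^{\uparrow\omega}$ there are an infinite $I\subseteq\omega$ and a sequence $\langle H_n:n\in I\rangle$ such that: $H_n\subseteq 2^{[h(n),h(n+1))}$ for all $n\in I$; $|H_n|\le g(n)$ for all $n\in I$; and for each $x\in X$, $x\restriction[h(n),h(n+1))\in H_n$ for all but finitely many $n\in I$. *)

(* Defs.v *)
From HB Require Import structures.
From mathcomp Require Import all_boot all_order all_algebra.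
From mathcomp Require Import all_classical all_reals all_analysis.

Set Implicit Arguments.
Unset Strict Implicit.
Unset Printing Implicit Defensive.

Local Open Scope nat_scope.
Local Open Scope classical_set_scope.

(* The interval [a, b) of natural numbers, as a finite type (empty if b <= a). *)
Definition nat_interval (a b : nat) : finType := {k : 'I_b | a <= k}.

Definition interval_nat (a b : nat) (k : nat_interval a b) : nat := val (val k).

Definition restr (a b : nat) (x : cantor_space) : {ffun nat_interval a b -> bool} :=
  [ffun k => x (interval_nat k)].

Definition nondecreasing_unbounded (h : nat -> nat) : Prop :=
  {homo h : m n / m <= n} /\ (forall m, exists n, m < h n).

(* The sequence <H_n : n in I> is a total function of n; its values at n not
   in I are never constrained nor used. *)
Definition T'_set (X : set cantor_space) : Prop :=
  exists g : nat -> nat, forall h : nat -> nat, nondecreasing_unbounded h ->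
    exists (I : set nat)
           (H : forall n, {set {ffun nat_interval (h n) (h n.+1) -> bool}}),
      [/\ infinite_set I,
          forall n, I n -> #|H n| <= g n
        & forall x, X x ->
            finite_set [set n | I n /\ restr (h n) (h n.+1) x \notin H n]].

(* Main.v *)
Require Import Defs.
From mathcomp Require Import all_boot all_order all_algebra.
From mathcomp Require Import all_classical all_reals all_analysis.

(** By compactness, [f x] below [m] depends only on [x] below some [phi m].
    Given [h], apply the hypothesis on [X] to the strictly increasing sequence
    [s 0 = 0], [s k.+1 >= phi (h (s k).+1)]: with [n = s k], the restriction of
    [f x] to [[h n, h n.+1)] is determined by [x] below [s k.+1], that is, by
    one of the [2 ^ n] initial segments of length [s k] and by one of the at
    most [g k] elements of the set given for [[s k, s k.+1)]. As [k <= s k = n],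
    the resulting number of values is bounded in terms of [n] only. *)

Local Open Scope classical_set_scope.

Definition agree (n : nat) (x y : cantor_space) : Prop :=
  forall i, i < n -> x i = y i.

Lemma agree_nbhs (n : nat) (x : cantor_space) : nbhs x (agree n x).
Proof.
elim: n => [|n IHn]; first by apply: filterS filterT => y _ i.
have nx : nbhs x [set y : cantor_space | y n = x n].
  exact: (@proj_continuous _ (fun=> bool) n x _ (discrete_set1 _)).
apply: filterS (filterI IHn nx) => y [xy yn] i.
by rewrite ltnS leq_eqVlt => /predU1P[->|/xy].
Qed.

(** The filter generated by the sets [agree n x] converges to [x] coordinatewise, hence in the
    product topology. *)
Lemma nbhs_agree (x : cantor_space) (U : set cantor_space) :
  nbhs x U -> exists n, agree n x `<=` U.
Proof.
pose F : set_system cantor_space :=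
  filter_from [set: nat] (fun n => agree n x).
have FF : Filter F.
  apply: filter_from_filter; first by exists 0.
  move=> m n _ _; exists (maxn m n) => // y xy; split=> i ilt.
    by apply: xy; rewrite leq_max ilt.
  by apply: xy; rewrite leq_max ilt orbT.
have Fx : F --> x.
  apply/(@pointwise_cvgP nat bool F x) => i A /nbhs_singleton Axi.
  by exists i.+1 => // y /(_ i (ltnSn i)) /= <-.
by move=> /Fx[n _ nU]; exists n.
Qed.

Lemma continuous_cantor_modulus (f : cantor_space -> cantor_space) :
  continuous f ->
  forall m, exists n, forall x y, agree n x y -> agree m (f x) (f y).
Proof.
move=> cf m.
have /compact_near_coveringP cpt := cantor_space_compact.
have /= := cpt nat \oo
  (fun n x => forall y, agree n x y -> agree m (f x) (f y)) _ _.
case=> [x _|N _ /(_ N (leqnn N)) NP]; last by exists N => x; exact: NP.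
have [n nP] := nbhs_agree _ _ (cf x _ (agree_nbhs m (f x))).
(* If [x'] agrees with [x] below [n], and [y] with [x'] below some [k >= n], then [f x'] and [f y]
   both agree with [f x] below [m]. *)
exists (agree n x, [set k | n <= k]) => /=.
  by split; [exact: agree_nbhs | exists n].
move=> [x' k] /= [xx' nk] y x'y i im.
rewrite -(nP x' xx' i im); apply: (nP y) => // j jn.
by rewrite xx' // x'y // (leq_trans jn).
Qed.

(** The value is [false] outside [[a, b)], so that extensions from disjoint intervals can be joined
    by a disjunction. *)
Definition extend {a b : nat} (u : {ffun nat_interval a b -> bool}) :
    cantor_space :=
  fun i => [exists k, (interval_nat k == i) && u k].

Lemma extend_restr (a b : nat) (x : cantor_space) (i : nat) :
  extend (restr a b x) i = [&& a <= i, i < b & x i].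
Proof.
apply/existsP/and3P => [[k /andP[/eqP <-]]|[ai ib xi]].
  by rewrite ffunE; split=> //; [exact: (valP k) | exact: ltn_ord].
by exists (Sub (Ordinal ib) ai : {k : 'I_b | a <= k}); rewrite eqxx ffunE.
Qed.

Definition glue {a b : nat} (u : {ffun nat_interval 0 a -> bool})
    (v : {ffun nat_interval a b -> bool}) : cantor_space :=
  fun i => extend u i || extend v i.

Lemma agree_glue (a b : nat) (x : cantor_space) :
  agree b x (glue (restr 0 a x) (restr a b x)).
Proof.
move=> i ib; rewrite /glue !extend_restr ib /=.
by case: leqP; rewrite /= ?orbF.
Qed.

Lemma eq_restr (a b : nat) (x y : cantor_space) :
  agree b x y -> restr a b x = restr a b y.
Proof. by move=> xy; apply/ffunP => k; rewrite !ffunE xy // ltn_ord. Qed.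

Lemma card_initial_segments (n : nat) :
  #|{ffun nat_interval 0 n -> bool}| <= 2 ^ n.
Proof.
rewrite card_ffun card_bool leq_exp2l // card_sig.
by rewrite (leq_trans (max_card _)) // card_ord.
Qed.

Section pull_back.
Variables (f : cantor_space -> cantor_space) (phi h : nat -> nat).
Hypothesis phiP : forall m x y, agree (phi m) x y -> agree m (f x) (f y).

Fixpoint sparse (k : nat) : nat :=
  if k is j.+1 then maxn (sparse j).+1 (phi (h (sparse j).+1)) else 0.

Lemma sparse_lt : {homo sparse : i j / i < j}.
Proof. by apply: homo_ltn ltn_trans _ => k /=; rewrite leq_maxl. Qed.

Lemma leq_sparse (k : nat) : k <= sparse k.
Proof. by elim: k => // k /leq_ltn_trans; apply; exact: sparse_lt. Qed.

Lemma sparse_mono : {mono sparse : i j / i <= j}.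
Proof. exact: leq_mono sparse_lt. Qed.

Lemma sparse_inj : injective sparse.
Proof. exact: incn_inj sparse_mono. Qed.

Lemma nondecreasing_unbounded_sparse : nondecreasing_unbounded sparse.
Proof.
split=> [i j|m]; first by rewrite sparse_mono.
by exists m.+1; exact: leq_sparse.
Qed.

Variable H : forall k,
  {set {ffun nat_interval (sparse k) (sparse k.+1) -> bool}}.

Definition image_at (n k : nat) :
    {set {ffun nat_interval (h n) (h n.+1) -> bool}} :=
  [set restr (h n) (h n.+1) (f (glue p.1 p.2)) | p in finset.setX finset.setT (H k)]%SET.

(* [k] is recovered from [n = sparse k] by a search, so as to avoid transporting
   along this equation; outside of the range of [sparse] the set is empty. *)
Definition image_slaloms (n : nat) :
    {set {ffun nat_interval (h n) (h n.+1) -> bool}} :=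
  (\bigcup_(k < n.+1 | sparse k == n) image_at n k)%SET.

Lemma image_slaloms_sparse (k : nat) :
  image_slaloms (sparse k) = image_at (sparse k) k.
Proof.
have klt : k < (sparse k).+1 by rewrite ltnS leq_sparse.
rewrite /image_slaloms (big_pred1 (Ordinal klt)) // => j.
by rewrite (inj_eq sparse_inj).
Qed.

Lemma card_image_slaloms (k : nat) :
  #|image_slaloms (sparse k)| <= 2 ^ sparse k * #|H k|.
Proof.
rewrite image_slaloms_sparse (leq_trans (leq_imset_card _ _)) //.
by rewrite cardsX cardsT leq_mul2r card_initial_segments orbT.
Qed.

Lemma restr_image_slaloms (k : nat) (x : cantor_space) :
  restr (sparse k) (sparse k.+1) x \in H k ->
  restr (h (sparse k)) (h (sparse k).+1) (f x) \in image_slaloms (sparse k).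
Proof.
move=> Hx; rewrite image_slaloms_sparse; apply/imsetP.
exists (restr 0 (sparse k) x, restr (sparse k) (sparse k.+1) x).
  by rewrite !inE.
(* The glued point agrees with [x] below [sparse k.+1], which is at least
   [phi (h (sparse k).+1)]. *)
apply/eq_restr/phiP => i ilt; apply: agree_glue.
by rewrite (leq_trans ilt) //= leq_maxr.
Qed.

End pull_back.

Theorem corollary10p3 (X : set cantor_space) (f : cantor_space -> cantor_space)
    (hf : continuous f) (hX : T'_set X) :
  T'_set (f @` X).
Proof.
have [g gP] := hX.
have [phi phiP] := choice (continuous_cantor_modulus f hf).
(* The bound must be chosen before [h], when the [k] with [sparse k = n] is not yet known; as
   [k <= n], the sum dominates [g k]. *)
exists (fun n => 2 ^ n * \sum_(k < n.+1) g k) => h _.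
have [I [H [Iinf Hg HX]]] := gP _ (nondecreasing_unbounded_sparse phi h).
exists (sparse phi h @` I), (image_slaloms f phi h H); split.
- apply: contra_not Iinf => /(@finite_preimage _ _ _ (sparse phi h)) fI.
  apply: sub_finite_set (fI _); first by move=> k Ik; exists k.
  by move=> i j _ _; exact: sparse_inj.
- move=> _ [k Ik <-].
  rewrite (leq_trans (card_image_slaloms f phi h H k)) // leq_mul2l.
  have klt : k < (sparse phi h k).+1 by rewrite ltnS leq_sparse.
  by rewrite (bigD1 (Ordinal klt)) //= (leq_trans (Hg k Ik)) ?leq_addr ?orbT.
- move=> _ [x Xx <-].
  (* A failure for [f x] at [sparse k] forces a failure for [x] at [k], and the latter are finitely
     many. *)
  apply: sub_finite_set (finite_image (sparse phi h) (HX x Xx)).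
  move=> _ [[k Ik <-] nH]; exists k => //; split=> //.
  exact: contra (restr_image_slaloms f phi h phiP H k x) nH.
Qed.
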